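(* Let $\mathcal{H}$ be a complex Hilbert space and let $A\in \mathcal{B}(\mathcal{H})$. Then $w^2(A)=\frac{1}{4}\left\|A^*A+AA^*\right\|$ if and only if $$\|\Re(e^{\mathrm{i}\theta}A)\|^2=\|\Im(e^{\mathrm{i}\theta}A)\|^2=\frac{1}{4}\|A^*A+AA^*\|\quad\text{for all }\theta\in\mathbb{R}.$$
   Context: $\mathcal{B}(\mathcal{H})$ denotes the algebra of all bounded linear operators on the complex Hilbert space $\mathcal{H}$, with operator norm $\|\cdot\|$ and adjoint $A^*$. The numerical radius is $w(A)=\sup\{|\langle Ax,x\rangle| : x\in\mathcal{H},\ \|x\|=1\}$, and $w^2(A)=(w(A))^2$. For $T\in\mathcal{B}(\mathcal{H})$, the real and imaginary parts are the operators $\Re(T)=\frac{T+T^*}{2}$ and $\Im(T)=\frac{T-T^*}{2\mathrm{i}}$. *)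

(* Defs.v *)
From HB Require Import structures.
From mathcomp Require Import all_boot all_order all_algebra.
From mathcomp Require Import complex.
From mathcomp Require Import all_classical all_reals all_analysis.

Set Implicit Arguments.
Unset Strict Implicit.
Unset Printing Implicit Defensive.

Import Order.TTheory GRing.Theory Num.Theory.
Import numFieldNormedType.Exports.

Local Open Scope classical_set_scope.
Local Open Scope complex_scope.
Local Open Scope ring_scope.

(* A complex Hilbert space: a complete normed space over R[i] whose norm is
   induced by an inner product, which is linear in its first argument and
   conjugate-linear in its second one. *)
HB.mixin Record CompleteNormedModule_isHilbert (R : realType) (V : Type)
    of CompleteNormedModule R[i] V := {
  inner : {dot V for Num.conj};
  inner_normE : forall x : V, inner x x = `|x| ^+ 2
}.

#[short(type="hilbertType")]
HB.structure Definition Hilbert (R : realType) :=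
  {V of CompleteNormedModule R[i] V & CompleteNormedModule_isHilbert R V}.

Section Operators.
Context {R : realType} {H : hilbertType R}.
Implicit Type T : H -> H.

(* Norms over R[i] take values in R[i]; [hnorm x] is [`|x|] as an element
   of R. *)
Definition hnorm (x : H) : R := complex.Re `|x|.

Definition bounded_operator T :=
  linear T /\ exists M : R, forall x, hnorm (T x) <= M * hnorm x.

Definition opnorm T : R := sup [set hnorm (T x) | x in [set x | hnorm x <= 1]].

(* If H = 0, the supremum is taken over the empty set and is 0. *)
Definition numerical_radius T : R :=
  sup [set complex.Re `|inner (T x) x| | x in [set x | hnorm x = 1]].

(* The vector z below exists (by the Riesz representation theorem) and is unique
   whenever T is a bounded operator; 0 is a default value for the other maps. *)
Definition adjoint T : H -> H :=
  fun y => xget 0 [set z | forall x, inner (T x) y = inner x z].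

Definition op_re T : H -> H := 2^-1 *: (T + adjoint T).

Definition op_im T : H -> H := (2 * 'i%C)^-1 *: (T - adjoint T).

End Operators.

Definition expi {R : realType} (theta : R) : R[i] := cos theta +i* sin theta.

(* Main.v *)
Require Import Defs.
From mathcomp Require Import all_boot all_order all_algebra.
From mathcomp Require Import complex.
From mathcomp Require Import all_classical all_reals all_analysis.
From mathcomp Require Import ring lra.

Import Order.TTheory GRing.Theory Num.Theory.
Import numFieldNormedType.Exports.

Local Open Scope ring_scope.

(* Write r(t) = |Re(e^it A)|.  As Im(e^it A) = Re(e^i(t - pi/2) A), the theorem
   is about r only.  Choosing t so that e^it <Ax, x> >= 0 shows that w(A) is the
   supremum of r.  Moreover A*A + AA* is unchanged when A is multiplied by e^it,
   and equals 2 (Re^2 + Im^2), so |A*A + AA*| <= 2 (r(t)^2 + r(t - pi/2)^2).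
   If w(A)^2 = |A*A + AA*| / 4, then both squares, being at most w(A)^2, equal
   it.  Conversely, if r is constant then w(A) = r(0). *)

(** * The real inner product underlying [inner], and its norm *)

Section RealInnerProduct.
Set Implicit Arguments.
Unset Strict Implicit.
Context {R : realType} {H : hilbertType R}.
Implicit Types (x y z v : H) (a : R[i]) (c : R).
Local Open Scope complex_scope.

(** This makes H a real inner product space with the same norm, so that estimates take place in the
    ordered field [R]. *)
Definition rdot x y : R := complex.Re (inner x y).

Lemma innerC x y : inner y x = conjc (inner x y).
Proof. by rewrite hermC expr0 mul1r. Qed.

Lemma innerZl a x y : inner (a *: x) y = a * inner x y.
Proof. exact: linearZl_LR. Qed.

Lemma innerZr a x y : inner x (a *: y) = conjc a * inner x y.
Proof. exact: linearZr_LR. Qed.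

Lemma hnormE x : (hnorm x)%:C = `|x|.
Proof. by rewrite RRe_real. Qed.

Lemma hnorm_ge0 x : 0 <= hnorm x.
Proof. by rewrite -ler0c hnormE. Qed.

Lemma hnorm0_eq0 x : hnorm x = 0 -> x = 0.
Proof. by move=> x0; apply/normr0_eq0; rewrite -hnormE x0. Qed.

Lemma ler_hnormD x y : hnorm (x + y) <= hnorm x + hnorm y.
Proof. by rewrite -lecR rmorphD /= !hnormE ler_normD. Qed.

Lemma hnormZ a x : hnorm (a *: x) = complex.Re `|a| * hnorm x.
Proof.
apply: complexI; rewrite rmorphM /= !hnormE normrZ.
by congr (_ * _); rewrite RRe_real.
Qed.

Lemma hnormZr c x : hnorm (c%:C *: x) = `|c| * hnorm x.
Proof. by rewrite hnormZ normc_def /= expr0n /= addr0 sqrtr_sqr. Qed.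

Lemma hnorm0 : hnorm (0 : H) = 0.
Proof. by rewrite /hnorm normr0. Qed.

Lemma hnorm_opp x : hnorm (- x) = hnorm x.
Proof. by rewrite /hnorm normrN. Qed.

Lemma rdotC x y : rdot x y = rdot y x.
Proof. by rewrite /rdot (innerC x y); case: (inner x y) => u v. Qed.

Lemma rdotDl x y z : rdot (x + y) z = rdot x z + rdot y z.
Proof. by rewrite /rdot linearDl raddfD. Qed.

Lemma rdotDr x y z : rdot x (y + z) = rdot x y + rdot x z.
Proof. by rewrite rdotC rdotDl !(rdotC x). Qed.

Lemma rdotZl c x y : rdot (c%:C *: x) y = c * rdot x y.
Proof.
by rewrite /rdot innerZl; case: (inner x y) => u v /=; rewrite mul0r subr0.
Qed.

Lemma rdotZr c x y : rdot x (c%:C *: y) = c * rdot x y.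
Proof. by rewrite rdotC rdotZl rdotC. Qed.

Lemma rdotNl x y : rdot (- x) y = - rdot x y.
Proof. by rewrite /rdot linearNl raddfN. Qed.

Lemma rdotNr x y : rdot x (- y) = - rdot x y.
Proof. by rewrite rdotC rdotNl rdotC. Qed.

Lemma rdotxx x : rdot x x = hnorm x ^+ 2.
Proof. by rewrite /rdot inner_normE -hnormE -rmorphXn. Qed.

(** Lets a complex identity be recovered from its real part, applied at x and at ix. *)
Lemma Im_inner x y : complex.Im (inner x y) = - rdot ('i%C *: x) y.
Proof. by rewrite /rdot innerZl; case: (inner x y) => u v /=; ring. Qed.

Lemma hnormD_sqr x y :
  hnorm (x + y) ^+ 2 = hnorm x ^+ 2 + hnorm y ^+ 2 + 2 * rdot x y.
Proof. by rewrite -!rdotxx !rdotDl !rdotDr (rdotC y x); ring. Qed.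

(* Cauchy-Schwarz is the triangle inequality squared. *)
Lemma rdot_le x y : rdot x y <= hnorm x * hnorm y.
Proof.
have : hnorm (x + y) ^+ 2 <= (hnorm x + hnorm y) ^+ 2.
  by rewrite lerXn2r ?nnegrE ?addr_ge0 ?hnorm_ge0 ?ler_hnormD.
by rewrite hnormD_sqr sqrrD; lra.
Qed.

End RealInnerProduct.

(** * Riesz representation for real functionals *)

Section Riesz.
Set Implicit Arguments.
Unset Strict Implicit.
Context {R : realType} {H : hilbertType R}.
Local Open Scope complex_scope.
Local Open Scope classical_set_scope.

(* The representing vector minimises x |-> |x|^2 - 2 f x; minimising points
   form a Cauchy filter by the parallelogram law. *)
Lemma riesz_real (f : H -> R) (M : R) :
    (forall x y, f (x + y) = f x + f y) ->
    (forall c x, f (c%:C *: x) = c * f x) ->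
    (forall x, f x <= M * hnorm x) ->
  exists z, forall x, f x = rdot x z.
Proof.
move=> fD fZ fM.
pose J x := hnorm x ^+ 2 - 2 * f x.
have J_lb : has_lbound (range J).
  (* Completing the square: |x|^2 - 2M|x| >= -M^2. *)
  exists (- M ^+ 2) => _ [x _ <-]; rewrite /J.
  by have := fM x; have := sqr_ge0 (hnorm x - M); rewrite sqrrB; lra.
have J_inf : has_inf (range J) by split => //; exists (J 0), 0.
pose m := inf (range J).
have mJ x : m <= J x by apply: ge_inf => //; exists x.
pose S (e : R) : set H := [set x | J x < m + e].
pose F := filter_from [set e : R | 0 < e] S.
have FF : ProperFilter F.
  apply: filter_from_proper; last first.
    by move=> e e0; have [_ [x _ <-] xm] := inf_adherent e0 J_inf; exists x.
  apply: filter_from_filter; first by exists 1 => /=.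
  move=> d e d0 e0; exists (Num.min d e); first by rewrite /= lt_min d0.
  by move=> x; rewrite /S /= -!ltrBlDl lt_min => /andP[].
have Fcauchy : cauchy F.
  apply: cauchy_exP => eps eps0.
  have [e e0 epsE] : exists2 e : R, 0 < e & eps = e%:C.
    have epsr : eps \is Num.real by rewrite realE (ltW eps0).
    by exists (complex.Re eps); rewrite ?RRe_real // -ltcR RRe_real.
  (* The parallelogram law reads |x - y|^2 = 2 J x + 2 J y - 4 J((x + y)/2). With the last value at
     least m, two points of [S d] satisfy |x - y|^2 < 4d, whence d = e^2/4. *)
  have e20 : 0 < e ^+ 2 / 4 by rewrite divr_gt0 ?exprn_gt0.
  have [_ [x _ <-] xm] := inf_adherent e20 J_inf.
  exists x; exists (e ^+ 2 / 4) => // y; rewrite /S /= => ym.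
  rewrite -ball_normE /ball_ /= epsE -hnormE ltcR.
  suff : hnorm (x - y) ^+ 2 < e ^+ 2.
    by rewrite ltr_pXn2r // ?nnegrE ?hnorm_ge0 // ltW.
  have := mJ (2^-1%:C *: (x + y)); rewrite /J in ym xm *.
  rewrite fZ fD hnormZr exprMn real_normK ?num_real //.
  rewrite -/m in xm; rewrite !hnormD_sqr hnorm_opp rdotNr in ym xm *; lra.
have /cvg_ex[z Fz] : cvg F by exact: cauchy_cvg.
(* The limit attains the infimum: moving from z to z + u lowers J z by at most 2(|z| + |M|)|u|, and
   each such u here has K|u| < e/4. *)
have zm : J z <= m.
  apply/ler_addgt0Pr => e e0.
  pose K := hnorm z + `|M| + 1.
  have K0 : 0 < K by rewrite ltr_wpDl // addr_ge0 ?hnorm_ge0.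
  have d0 : 0 < e / 4 / K by rewrite !divr_gt0.
  have dC0 : 0 < (e / 4 / K)%:C by rewrite ltcR.
  have Fball : F (ball z (e / 4 / K)%:C).
    by apply: Fz; exact: nbhsx_ballx.
  have FS : F (S (e / 4)) by exists (e / 4) => //=; rewrite divr_gt0.
  have [x []] := filter_ex (filterI Fball FS).
  rewrite -ball_normE /ball_ /= -hnormE ltcR /S /= => zx xm.
  have xE : x = z + (x - z) by rewrite addrC subrK.
  rewrite -hnorm_opp opprB in zx; move: xm; rewrite xE.
  move: (x - z) zx {xE} => u; rewrite ltr_pdivlMr // /K => uK.
  rewrite /J hnormD_sqr fD.
  have := rdot_le z (- u); rewrite rdotNr hnorm_opp.
  have : f u <= `|M| * hnorm u.
    by rewrite (le_trans (fM u)) // ler_wpM2r ?hnorm_ge0 // ler_norm.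
  have := sqr_ge0 (hnorm u); have := hnorm_ge0 u.
  by lra.
exists z => x.
pose n := hnorm x ^+ 2; pose b := f x - rdot x z.
have n0 : 0 <= n by apply: sqr_ge0.
(* Minimality of z along x gives 0 <= t^2 n - 2tb, which for this t is -t^2 (n + 2), so t = 0. The +
   1 keeps the denominator positive when x = 0. *)
pose t := b / (n + 1).
have bE : b = t * (n + 1) by rewrite divfK // gt_eqF // ltr_wpDl.
have := le_trans zm (mJ (z + t%:C *: x)).
rewrite /J hnormD_sqr fD fZ rdotZr hnormZr exprMn real_normK ?num_real //.
rewrite -/n (rdotC z).
have -> : f x = b + rdot x z by rewrite subrK.
suff t0 : t ^+ 2 <= 0 -> t = 0.
  move=> h; suff -> : b = 0 by rewrite add0r.
  rewrite bE t0 ?mul0r //; move: h; rewrite bE.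
  have := mulr_ge0 (sqr_ge0 t) n0; rewrite !expr2; lra.
by move=> t0; apply/eqP; rewrite -sqrf_eq0 eq_le t0 sqr_ge0.
Qed.

End Riesz.

(** * Algebra of bounded operators *)

Section Operators.
Set Implicit Arguments.
Unset Strict Implicit.
Context {R : realType} {H : hilbertType R}.
Implicit Types (S T : H -> H) (x y : H) (a : R[i]) (M : R).
Local Open Scope complex_scope.
Local Open Scope classical_set_scope.

Lemma bounded_operator_bound T : bounded_operator T ->
  exists2 M, 0 <= M & forall x, hnorm (T x) <= M * hnorm x.
Proof.
move=> [_ [M TM]]; exists `|M| => // x; rewrite (le_trans (TM x)) //.
by rewrite ler_wpM2r ?hnorm_ge0 // ler_norm.
Qed.

Lemma bounded_operatorB T : bounded_operator T -> {morph T : x y / x - y}.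
Proof.
by move=> [Tlin _] x y; rewrite [x - y]addrC -scaleN1r Tlin scaleN1r addrC.
Qed.

Lemma bounded_operator0 T : bounded_operator T -> T 0 = 0.
Proof. by move=> Tb; have := bounded_operatorB Tb 0 0; rewrite !subrr. Qed.

Lemma bounded_operatorN T : bounded_operator T -> {morph T : x / - x}.
Proof.
by move=> Tb x; have := bounded_operatorB Tb 0 x;
  rewrite bounded_operator0 // !sub0r.
Qed.

Lemma bounded_operatorD T : bounded_operator T -> {morph T : x y / x + y}.
Proof.
move=> Tb x y; have /= := bounded_operatorB Tb x (- y);
  by rewrite (bounded_operatorN Tb y) !opprK.
Qed.

Lemma bounded_operatorZ T : bounded_operator T ->
  forall a, {morph T : x / a *: x}.
Proof.
by move=> Tb a x; have [Tlin _] := Tb; have := Tlin a x 0;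
  rewrite (bounded_operator0 Tb) !addr0.
Qed.

Lemma bounded_operator_add S T :
  bounded_operator S -> bounded_operator T -> bounded_operator (S + T).
Proof.
move=> Sb Tb; split.
  move=> a x y; rewrite !fctE; move: Sb Tb => [Sl _] [Tl _].
  by rewrite Sl Tl scalerDr addrACA.
have [M _ SM] := bounded_operator_bound Sb.
have [N _ TN] := bounded_operator_bound Tb.
exists (M + N) => x; rewrite mulrDl (le_trans (ler_hnormD _ _)) //.
by rewrite lerD.
Qed.

Lemma bounded_operator_scale a T :
  bounded_operator T -> bounded_operator (a *: T).
Proof.
move=> Tb; split.
  by move=> b x y; rewrite !fctE; case: Tb => -> _;
    rewrite scalerDr !scalerA mulrC.
have [M _ TM] := bounded_operator_bound Tb.
exists (complex.Re `|a| * M) => x; rewrite hnormZ -mulrA ler_wpM2l //.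
by rewrite -ler0c RRe_real ?normr_real.
Qed.

(** * Adjoints, real parts and imaginary parts *)

Lemma inner_ext x y : (forall z : H, inner z x = inner z y) -> x = y.
Proof.
move=> xy; apply/eqP; rewrite -subr_eq0; apply/eqP/hnorm0_eq0/eqP.
by rewrite -sqrf_eq0 -rdotxx /rdot linearBr /= xy subrr.
Qed.

(** Riesz representation of v |-> [rdot (T v) y] shows that the set defining [adjoint] is nonempty,
    so [xget] does not return its default 0. *)
Lemma inner_adjoint T x y : bounded_operator T ->
  inner (T x) y = inner x (adjoint T y).
Proof.
move=> Tb; rewrite /adjoint; case: xgetP => [z _ ->//|noz].
exfalso; have [M M0 TM] := bounded_operator_bound Tb.
have [|||z fz] := @riesz_real R H (fun v => rdot (T v) y) (M * hnorm y).
- by move=> u v; rewrite bounded_operatorD // rdotDl.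
- by move=> c u; rewrite bounded_operatorZ // rdotZl.
- move=> u; rewrite (le_trans (rdot_le _ _)) // mulrAC ler_wpM2r ?hnorm_ge0 //.
(* Real parts agree by the choice of z; imaginary parts are real parts at iv, and T commutes with
   i. *)
apply: (noz z) => v; apply/eqP; rewrite eq_complex !Im_inner -!/(rdot _ _).
by rewrite -bounded_operatorZ // !fz !eqxx.
Qed.

Lemma rdot_adjoint T x y : bounded_operator T ->
  rdot (T x) y = rdot x (adjoint T y).
Proof. by move=> Tb; rewrite /rdot inner_adjoint. Qed.

Lemma adjointP S T : bounded_operator T ->
  (forall x y, inner (T x) y = inner x (S y)) -> adjoint T = S.
Proof.
move=> Tb TS; apply/funext => y; apply: inner_ext => x.
by rewrite -inner_adjoint.
Qed.

Lemma adjoint_scale a T : bounded_operator T ->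
  adjoint (a *: T) = conjc a *: adjoint T.
Proof.
move=> Tb; apply: adjointP; first exact: bounded_operator_scale.
by move=> x y; rewrite !fctE innerZl innerZr conjcK inner_adjoint.
Qed.

Lemma bounded_operator_adjoint T : bounded_operator T ->
  bounded_operator (adjoint T).
Proof.
move=> Tb; split.
  move=> a x y; apply: inner_ext => z.
  by rewrite linearDr /= innerZr -!inner_adjoint // linearDr /= innerZr.
have [M M0 TM] := bounded_operator_bound Tb.
exists M => y; have [->|n0] := eqVneq (hnorm (adjoint T y)) 0.
  by rewrite mulr_ge0 ?hnorm_ge0.
(* |T*y|^2 = Re <T T*y, y> <= M |T*y| |y|, to be divided by |T*y|. *)
rewrite -(ler_pM2l (x := hnorm (adjoint T y))) ?lt_def ?n0 ?hnorm_ge0 //.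
rewrite -expr2 -rdotxx -rdot_adjoint // (le_trans (rdot_le _ _)) //.
by rewrite mulrA ler_wpM2r ?hnorm_ge0 // mulrC TM.
Qed.

Lemma op_re_bounded T : bounded_operator T -> bounded_operator (op_re T).
Proof.
move=> Tb; apply/bounded_operator_scale/bounded_operator_add => //.
exact: bounded_operator_adjoint.
Qed.

(** The adjoint of -iT is iT*, and 1/(2i) = -i/2. Facts on imaginary parts thus reduce to real
    parts. *)
Lemma op_imE T : bounded_operator T -> op_im T = op_re ((- 'i%C) *: T).
Proof.
move=> Tb; rewrite /op_im /op_re adjoint_scale //; apply/funext => x;
  rewrite !fctE.
have -> : conjc (- 'i%C) = 'i%C :> R[i].
  by apply/eqP; rewrite eq_complex /= opprK oppr0 !eqxx.
have e : (2 * 'i%C)^-1 = - (2^-1 * 'i%C) :> R[i].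
  by rewrite invfM complexiE invCi mulrN.
by rewrite scalerBr scalerDr !scalerA e mulrN !scaleNr opprK.
Qed.

Lemma rdot_op_re T x y : bounded_operator T ->
  rdot (op_re T x) y = 2^-1 * (rdot (T x) y + rdot x (T y)).
Proof.
move=> Tb; rewrite /op_re !fctE.
have -> : (2^-1 : R[i]) = (2^-1)%:C by rewrite fmorphV rmorph_nat.
by rewrite rdotZl rdotDl (rdotC (adjoint T x)) -rdot_adjoint // (rdotC x).
Qed.

(** * The operator norm *)

Lemma opnorm_bound_set T M : 0 <= M -> (forall x, hnorm (T x) <= M * hnorm x) ->
  ubound [set hnorm (T x) | x in [set x | hnorm x <= 1]] M.
Proof.
move=> M0 TM _ [x /= x1 <-]; rewrite (le_trans (TM x)) //.
by rewrite -[leRHS]mulr1 ler_wpM2l.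
Qed.

Lemma opnorm_le T M : 0 <= M -> (forall x, hnorm (T x) <= M * hnorm x) ->
  opnorm T <= M.
Proof.
move=> M0 TM; apply: ge_sup; last exact: opnorm_bound_set.
by exists (hnorm (T 0)), 0 => //=; rewrite hnorm0.
Qed.

Lemma le_opnorm1 T x : bounded_operator T -> hnorm x <= 1 ->
  hnorm (T x) <= opnorm T.
Proof.
move=> Tb x1; have [M M0 TM] := bounded_operator_bound Tb.
by apply: ub_le_sup; [exists M; exact: opnorm_bound_set|exists x].
Qed.

Lemma opnorm_ge0 T : bounded_operator T -> 0 <= opnorm T.
Proof.
by move=> Tb; rewrite (le_trans _ (@le_opnorm1 T 0 Tb _)) ?hnorm_ge0 ?hnorm0.
Qed.

Lemma normalized x : x != 0 ->
  exists2 u : H, hnorm u = 1 & x = (hnorm x)%:C *: u.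
Proof.
move=> x0; have n0 : hnorm x != 0 by apply: contra_neq x0 => /hnorm0_eq0.
exists ((hnorm x)^-1%:C *: x);
  last by rewrite scalerA -rmorphM mulfV // scale1r.
by rewrite hnormZr normfV ger0_norm ?hnorm_ge0 // mulVf.
Qed.

Lemma le_opnorm T x : bounded_operator T -> hnorm (T x) <= opnorm T * hnorm x.
Proof.
move=> Tb; have [->|/normalized[u u1 ->]] := eqVneq x 0.
  by rewrite bounded_operator0 // hnorm0 mulr0.
rewrite bounded_operatorZ // !hnormZr u1 mulr1 mulrC ler_wpM2r //.
by rewrite le_opnorm1 ?u1.
Qed.

Lemma rdot_opnorm T x : bounded_operator T ->
  rdot (T x) x <= opnorm T * hnorm x ^+ 2.
Proof.
move=> Tb; rewrite (le_trans (rdot_le _ _)) // expr2 mulrA.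
by rewrite ler_wpM2r ?hnorm_ge0 ?le_opnorm.
Qed.

End Operators.

(** * The numerical radius and its relation to operator norms *)

Section NumericalRadius.
Set Implicit Arguments.
Unset Strict Implicit.
Context {R : realType} {H : hilbertType R}.
Implicit Types (S T : H -> H) (x y : H) (a : R[i]) (M : R).
Local Open Scope complex_scope.
Local Open Scope classical_set_scope.

Lemma Re_norm_ge0 a : 0 <= complex.Re `|a|.
Proof. by rewrite -ler0c RRe_real ?normr_real. Qed.

Lemma Re_norm_sqr a : complex.Re (conjc a * a) = complex.Re `|a| ^+ 2.
Proof.
by rewrite mulrC -sqr_normc -[in LHS](RRe_real (normr_real a)) -rmorphXn.
Qed.

(** With z = <x, y>, the real Cauchy-Schwarz inequality for conj(z) x and y reads |z|^2 <= |z| |x|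
    |y|. *)
Lemma norm_inner_le x y : complex.Re `|inner x y| <= hnorm x * hnorm y.
Proof.
set z := inner x y; have := rdot_le (conjc z *: x) y.
rewrite /rdot innerZl -/z Re_norm_sqr hnormZ normcJ expr2 -mulrA.
have := Re_norm_ge0 z; rewrite le0r => /orP[/eqP -> _|z0].
  by rewrite mulr_ge0 ?hnorm_ge0.
by rewrite ler_pM2l.
Qed.

Lemma numerical_radius_le T M : 0 <= M ->
  (forall x, hnorm x = 1 -> complex.Re `|inner (T x) x| <= M) ->
  numerical_radius T <= M.
Proof.
move=> M0 TM; rewrite /numerical_radius; set E := image _ _.
(* If H = 0 there is no unit vector and the supremum is 0, which is where [0 <= M] enters. *)
have [->|/set0P E0] := eqVneq E set0; first by rewrite sup0.
by apply: ge_sup => // _ [x /= x1 <-]; exact: TM.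
Qed.

Lemma le_numerical_radius1 T x : bounded_operator T -> hnorm x = 1 ->
  complex.Re `|inner (T x) x| <= numerical_radius T.
Proof.
move=> Tb x1; apply: ub_le_sup; last by exists x.
exists (opnorm T) => _ [y /= y1 <-].
by rewrite (le_trans (norm_inner_le _ _)) // y1 mulr1 le_opnorm1 ?y1.
Qed.

Lemma numerical_radius_ge0 T : bounded_operator T -> 0 <= numerical_radius T.
Proof.
move=> Tb; rewrite /numerical_radius; set E := image _ _.
have [->|/set0P[_ [x /= x1 _]]] := eqVneq E set0; first by rewrite sup0.
by rewrite (le_trans _ (le_numerical_radius1 Tb x1)) ?Re_norm_ge0.
Qed.

Lemma le_numerical_radius T x : bounded_operator T ->
  complex.Re `|inner (T x) x| <= numerical_radius T * hnorm x ^+ 2.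
Proof.
move=> Tb; have [->|/normalized[u u1 ->]] := eqVneq x 0.
  by rewrite linear0r normr0 hnorm0 expr0n mulr0.
rewrite bounded_operatorZ // innerZl innerZr conjc_real hnormZr u1 mulr1.
rewrite mulrA -rmorphM -expr2 normrM ger0_norm ?ler0c ?sqr_ge0 //.
rewrite real_normK ?num_real // mulrC.
rewrite -(RRe_real (normr_real (inner (T u) u))) -rmorphM /=.
by rewrite ler_wpM2r ?sqr_ge0 // le_numerical_radius1.
Qed.

(** The left side is also the quadratic form of Re(aT); this is the bound fed to
    [opnorm_selfadjoint_le]. *)
Lemma numerical_radius_scale a T : bounded_operator T -> `|a| = 1 ->
  forall x, `|rdot ((a *: T) x) x| <= numerical_radius T * hnorm x ^+ 2.
Proof.
move=> Tb a1 x; rewrite -lecR (le_trans (normc_ge_Re _)) // !fctE innerZl.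
rewrite normrM a1 mul1r -(RRe_real (normr_real (inner (T x) x))) lecR.
exact: le_numerical_radius.
Qed.

(* Polarization of <T u, v> with v the unit vector along T u. *)
Lemma opnorm_selfadjoint_le T M : bounded_operator T -> 0 <= M ->
    (forall x y, rdot (T x) y = rdot x (T y)) ->
    (forall x, `|rdot (T x) x| <= M * hnorm x ^+ 2) ->
  opnorm T <= M.
Proof.
move=> Tb M0 Tsym TM.
(* The forms at x + y and x - y differ by 4 [rdot (T x) y]; the parallelogram law adds up their
   bounds. *)
have pol x y : 2 * rdot (T x) y <= M * (hnorm x ^+ 2 + hnorm y ^+ 2).
  have := TM (x + y); have := TM (x - y).
  rewrite bounded_operatorB // bounded_operatorD // !hnormD_sqr hnorm_opp
    rdotNr.
  rewrite !rdotDl !rdotDr !rdotNl !rdotNr (Tsym y x) (rdotC y).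
  by rewrite !ler_norml => /andP[? ?] /andP[? ?]; lra.
apply: opnorm_le => // x.
have [->|/normalized[u u1 ->]] := eqVneq x 0.
  by rewrite bounded_operator0 // hnorm0 mulr0.
rewrite bounded_operatorZ // !hnormZr u1 mulr1 mulrC ler_wpM2r //.
have [->|/normalized[v v1 TuE]] := eqVneq (T u) 0; first by rewrite hnorm0.
have := pol u v;
  rewrite TuE rdotZl rdotxx u1 v1 hnormZr v1 ger0_norm ?hnorm_ge0 //; lra.
Qed.

(** * Phases, and w(T) as the supremum of |Re(e^it T)| *)

Lemma norm_expi (t : R) : `|expi t| = 1.
Proof. by rewrite normc_def /= cos2Dsin2 sqrtr1. Qed.

(** For nonzero a the phase is conj(a)/|a|; a unimodular p + iq has argument acos p or -acos p
    according to the sign of q. *)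
Lemma phase_exists a : exists t : R, expi t * a = `|a|.
Proof.
have [->|a0] := eqVneq a 0; first by exists 0; rewrite mulr0 normr0.
have : `|conjc a / `|a| | = 1.
  by rewrite normrM normcJ normfV normr_id mulfV ?normr_eq0.
suff key (u : R[i]) : `|u| = 1 -> exists t, expi t = u.
  move=> /key[t tE]; exists t;
    rewrite tE mulrAC [_ * a]mulrC -sqr_normc expr2 mulfK //.
  by rewrite normr_eq0.
case: u => p q; rewrite normc_def /= => -[] /(congr1 (fun r => r ^+ 2)).
rewrite sqr_sqrtr ?addr_ge0 ?sqr_ge0 // expr1n => pq.
have p1 : -1 <= p <= 1.
  rewrite -ler_norml -(@expr_le1 _ 2%N) ?normr_ge0 // real_normK ?num_real //.
  by rewrite -pq lerDl sqr_ge0.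
have [q0|q0] := leP 0 q.
  exists (acos p); rewrite /expi acosK // sin_acos //; congr Complex.
  by rewrite -pq addrAC subrr add0r sqrtr_sqr ger0_norm.
exists (- acos p); rewrite /expi cosN sinN acosK // sin_acos //; congr Complex.
by rewrite -pq addrAC subrr add0r sqrtr_sqr ltr0_norm // opprK.
Qed.

Lemma expi_subpihalf (t : R) : - 'i%C * expi t = expi (t - pi / 2).
Proof.
rewrite /expi cosB sinB cos_pihalf sin_pihalf; apply/eqP; rewrite eq_complex /=.
by apply/andP; split; apply/eqP; ring.
Qed.

Lemma op_im_expi T t : bounded_operator T ->
  op_im (expi t *: T) = op_re (expi (t - pi / 2) *: T).
Proof.
by move=> Tb; rewrite op_imE ?scalerA ?expi_subpihalf //;
  exact: bounded_operator_scale.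
Qed.

(** Re(e^it T) is self-adjoint, so its norm is controlled by its quadratic form Re(e^it <Tx, x>). *)
Lemma opnorm_re_le T t : bounded_operator T ->
  opnorm (op_re (expi t *: T)) <= numerical_radius T.
Proof.
move=> Tb.
have eTb : bounded_operator (expi t *: T) by exact: bounded_operator_scale.
apply: opnorm_selfadjoint_le.
- exact: op_re_bounded.
- exact: numerical_radius_ge0.
- by move=> x y; rewrite [RHS]rdotC !rdot_op_re // (rdotC x) (rdotC y) addrC.
move=> x; rewrite rdot_op_re // (rdotC x).
have := numerical_radius_scale Tb (norm_expi t) x.
by rewrite !ler_norml => /andP[? ?]; apply/andP; split; lra.
Qed.

Lemma numerical_radius_le_re T M : bounded_operator T -> 0 <= M ->
    (forall t, opnorm (op_re (expi t *: T)) <= M) ->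
  numerical_radius T <= M.
Proof.
move=> Tb M0 TM; apply: numerical_radius_le => // x x1.
have [t tE] := phase_exists (inner (T x) x); rewrite -tE -innerZl.
have eTb : bounded_operator (expi t *: T) by exact: bounded_operator_scale.
apply: le_trans (TM t); have := rdot_opnorm x (op_re_bounded eTb).
by rewrite rdot_op_re // (rdotC x) x1 expr1n mulr1 /rdot !fctE; lra.
Qed.

(** In terms of moduli, |T|^2 + |T*|^2. *)
Definition modulus_sum T := (adjoint T \o T) + (T \o adjoint T).

(** Each product contains one factor a and one conj(a), which cancel. *)
Lemma modulus_sum_scale a T : bounded_operator T -> `|a| = 1 ->
  modulus_sum (a *: T) = modulus_sum T.
Proof.
move=> Tb a1; have aa : a * conjc a = 1 by rewrite -sqr_normc a1 expr1n.
rewrite /modulus_sum adjoint_scale //; apply/funext => x; rewrite !fctE /=.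
have Cb := bounded_operator_adjoint Tb.
rewrite (bounded_operatorZ Tb) (bounded_operatorZ Cb).
by rewrite !scalerA aa [_ * a]mulrC aa !scale1r.
Qed.

Lemma modulus_sumE T x : bounded_operator T ->
  modulus_sum T x = 2%:C *: (op_re T (op_re T x) + op_im T (op_im T x)).
Proof.
move=> Tb; have Cb := bounded_operator_adjoint Tb.
rewrite /modulus_sum /op_re /op_im !fctE /=; move: (adjoint T) Cb => C Cb.
rewrite !(bounded_operatorZ Tb) !(bounded_operatorZ Cb) !(bounded_operatorB Tb).
rewrite !(bounded_operatorB Cb) !(bounded_operatorD Tb) !(bounded_operatorD Cb).
rewrite -scalerBr -scalerDr !scalerA.
have -> : (2 * 'i%C)^-1 * (2 * 'i%C)^-1 = - (2^-1 * 2^-1) :> R[i].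
  rewrite !invfM mulrACA complexiE invCi mulrNN -['i%R * _]expr2.
  by rewrite sqrCi mulrN1.
rewrite scaleNr -scalerBr scalerA.
have -> : T (T x) + T (C x) + (C (T x) + C (C x)) -
    (T (T x) - T (C x) - (C (T x) - C (C x))) = (C (T x) + T (C x)) *+ 2.
  rewrite [C (T x) + C (C x)]addrC addrACA [T (C x) + _]addrC.
  rewrite [- (C (T x) - _)]opprB [T (T x) - _ + _]addrACA -opprD.
  rewrite [T (C x) + _]addrC.
  by rewrite opprB [LHS]addrC [LHS]addrA subrK -mulr2n.
rewrite -[in RHS](scaler_nat _ (C (T x) + _)) scalerA -[LHS]scale1r;
  congr (_ *: _).
by rewrite rmorph_nat; field.
Qed.

Lemma opnorm_modulus_sum_le T : bounded_operator T ->
  opnorm (modulus_sum T) <= 2 * (opnorm (op_re T) ^+ 2 + opnorm (op_im T) ^+ 2).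
Proof.
move=> Tb; have reb := op_re_bounded Tb.
have imb : bounded_operator (op_im T).
  by rewrite op_imE //; exact/op_re_bounded/bounded_operator_scale.
apply: opnorm_le => [|x]; first by rewrite mulr_ge0 // addr_ge0 ?sqr_ge0.
rewrite modulus_sumE // hnormZr ger0_norm // -mulrA ler_pM2l // mulrDl.
rewrite (le_trans (ler_hnormD _ _)) // lerD // expr2 -mulrA.
  by rewrite (le_trans (le_opnorm _ _)) // ler_wpM2l ?opnorm_ge0 ?le_opnorm.
by rewrite (le_trans (le_opnorm _ _)) // ler_wpM2l ?opnorm_ge0 ?le_opnorm.
Qed.

End NumericalRadius.

Theorem theorem2p14 (R : realType) (H : hilbertType R) (A : H -> H)
    (bddA : bounded_operator A) :
  numerical_radius A ^+ 2 = 1 / 4 * opnorm ((adjoint A \o A) + (A \o adjoint A))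
  <->
  (forall theta : R,
     opnorm (op_re (expi theta *: A)) ^+ 2
       = opnorm (op_im (expi theta *: A)) ^+ 2
     /\
     opnorm (op_im (expi theta *: A)) ^+ 2
       = 1 / 4 * opnorm ((adjoint A \o A) + (A \o adjoint A))).
Proof.
rewrite -/(modulus_sum A); set q := opnorm (modulus_sum A);
  set w := numerical_radius A.
pose r t := opnorm (op_re (expi t *: A)).
have eAb t : bounded_operator (expi t *: A) by exact: bounded_operator_scale.
have r0 t : 0 <= r t by exact/opnorm_ge0/op_re_bounded.
have w0 : 0 <= w by exact: numerical_radius_ge0.
have rw t : r t ^+ 2 <= w ^+ 2 by rewrite lerXn2r ?nnegrE // opnorm_re_le.
split=> [wq t|rq].
  have : q <= 2 * (r t ^+ 2 + r (t - pi / 2) ^+ 2).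
    rewrite /q -(modulus_sum_scale bddA (norm_expi t)) /r -op_im_expi //.
    exact: opnorm_modulus_sum_le.
  (* Both squares are at most w^2 = q/4 while their sum is at least q/2, so each equals q/4. *)
  have := rw t; have := rw (t - pi / 2); rewrite op_im_expi // -/(r _) -/(r _).
  by rewrite wq; split; lra.
(* Thus r is constant, and r(0) bounds every r(t), hence also w. *)
have rE t : r t ^+ 2 = 1 / 4 * q by have [re im] := rq t; rewrite /r re im.
apply: le_anti; rewrite -(rE 0) rw andbT lerXn2r ?nnegrE //.
apply: numerical_radius_le_re => // t; rewrite -/(r t).
by rewrite -(@ler_pXn2r _ 2%N) ?nnegrE // !rE.
Qed.
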